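(* Let $k>1$ be an integer and let $p_i$ denote the $i$-th prime. For any point $(\alpha,\beta)\in\omega(2p_k)$, the ratio $$\frac{\Omega_0\big(p_k\,|\,\alpha,\beta\,|\,2p_k\big)}{\Psi(\alpha,\beta,2p_k)}$$ is an integer, and $$\prod_{i=2}^{k+1}p_i\ \Big|\ \frac{\Omega_0\big(p_k\,|\,\alpha,\beta\,|\,2p_k\big)}{\Psi(\alpha,\beta,2p_k)}.$$ Furthermore, for any finite set $\varpi\subset\omega(2p_k)$ and any finite set $I$ of integers, $$\prod_{i=2}^{k+1}p_i\ \Big|\ \sum_{(\alpha,\beta)\in\varpi,\ \lambda\in I}\lambda\,\frac{\Omega_0\big(p_k\,|\,\alpha,\beta\,|\,2p_k\big)}{\Psi(\alpha,\beta,2p_k)}.$$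
   Context: For an integer $m\ge 0$, $\delta(m)\in\{0,1\}$ is the residue of $m$ modulo $2$. For real $(a,b)\neq(0,0)$ the sequence $\Psi(n)=\Psi(a,b,n)$ is defined by $\Psi(0)=2$, $\Psi(1)=1$, $\Psi(n+1)=(2a-b)^{\delta(n)}\Psi(n)-a\Psi(n-1)$ for $n\ge1$ (with $t^0=1$ for every $t$). For a positive integer $n$ and a point $(\zeta,\xi)\ne(0,0)$, the Omega sequence $\Omega_r(k|\zeta,\xi|n)$, for integers $r,k\ge 0$ with $r+k\le\lfloor n/2\rfloor$, is defined by $\Omega_r(0|\zeta,\xi|n)=1$ for all $r$ and, for $k\ge 1$, $$\Omega_r(k|\zeta,\xi|n)=(2\zeta-\xi)(n-r-k)\,\Omega_r(k-1|\zeta,\xi|n)-2\zeta\,(n-2r-\delta(n-1))\,\Omega_{r+1}(k-1|\zeta,\xi|n).$$ The Omega space at level $n$ is $\omega(n)=\{(a,b)\,:\,(a,b)\neq(0,0),\ \Psi(a,b,n)\ne 0\}$ (pairs of real numbers). The primes are indexed $p_1=2,p_2=3,\dots$. *)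

(* Defs.v *)
(* MathComp; the real numbers are an arbitrary R : realType. *)
From HB Require Import structures.
From mathcomp Require Import all_boot all_order all_algebra.
From mathcomp Require Import finmap.
From mathcomp Require Import reals.

Set Implicit Arguments.
Unset Strict Implicit.
Unset Printing Implicit Defensive.

Import Order.TTheory GRing.Theory Num.Theory.
Local Open Scope ring_scope.

Definition delta (m : nat) : nat := (m %% 2)%N.

Fixpoint Psi (R : realType) (a b : R) (n : nat) {struct n} : R :=
  match n with
  | 0%N => 2
  | m.+1 =>
      match m with
      | 0%N => 1
      | l.+1 => (2 * a - b) ^+ delta m * Psi a b m - a * Psi a b l
      end
  end.

(* Omega zeta xi n r k is Omega_r(k | zeta, xi | n).  Inside the range
   r + k <= n./2 the recursion only calls values in that range; the values
   outside it are irrelevant.  The integer factors are formed by subtraction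
   in R, so there is no truncation except in n.-1 (n is positive). *)
Fixpoint Omega (R : realType) (zeta xi : R) (n r k : nat) {struct k} : R :=
  match k with
  | 0%N => 1
  | j.+1 =>
      (2 * zeta - xi) * (n%:R - r%:R - k%:R) * Omega zeta xi n r j
      - 2 * zeta * (n%:R - 2 * r%:R - (delta n.-1)%:R)
          * Omega zeta xi n r.+1 j
  end.

Definition Omega_space (R : realType) (n : nat) : {pred R * R} :=
  [pred x : R * R | (x != (0, 0)) && (Psi x.1 x.2 n != 0)].
Arguments Omega_space : clear implicits.

Lemma ex_prime_gt (m : nat) : exists p, (m < p)%N && prime p.
Proof. by have [p mp pp] := prime_above m; exists p; rewrite mp. Qed.

Definition next_prime (m : nat) : nat := ex_minn (ex_prime_gt m).

(* 1-based: nth_prime 1 = 2, nth_prime 2 = 3; nth_prime 0 = 0 is a dummy. *)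
Definition nth_prime (i : nat) : nat := iter i next_prime 0%N.

Lemma nth_prime1 : nth_prime 1 = 2%N.
Proof.
rewrite /nth_prime /= /next_prime; case: ex_minnP => p /andP[_ pp] minp.
by apply/eqP; rewrite eqn_leq (minp 2%N) // prime_gt1.
Qed.

Lemma nth_primeS (i : nat) :
  [/\ prime (nth_prime i.+1), (nth_prime i < nth_prime i.+1)%N
    & forall q, prime q -> (nth_prime i < q)%N -> (nth_prime i.+1 <= q)%N].
Proof.
rewrite /nth_prime iterS /next_prime; case: ex_minnP => p /andP[ip pp] minp.
by split=> // q pq iq; apply: minp; rewrite iq.
Qed.

(* x is an integer (viewed in R) and d divides it. *)
Definition int_multiple (R : realType) (d : nat) (x : R) : Prop :=
  exists2 z : int, x = z%:~R & (d%:Z %| z)%Z.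

(* Main.v *)
Require Import Defs.
From HB Require Import structures.
From mathcomp Require Import all_boot all_order all_algebra.
From mathcomp Require Import finmap.
From mathcomp Require Import reals.
From mathcomp Require Import zify ring.

(** Write c = 2a - b and m = p_k, and let n be even.  Unfolding the recursion of Omega gives a sum
    over paths, each step of which either multiplies by
    c (n - r - k) and lowers k, or multiplies by -2a (n - 2r - 1) and moves
    one unit from k to r.  The first factor depends only on r + k and the
    second only on r, so the weight of a path depends only on the number j of
    steps of the second kind, and Omega_r(k) is an explicit sum over j with
    'C(k, j) paths each ([Omega_closed]).  The sequence Psi is a homogeneous
    Lucas sequence, with the classical expansion whose coefficients are
    n / (n - j) * 'C(n - j, j) ([Psi_closed], [lucas_coef_fact]).  Comparing
    the two expansions at n = 2m coefficient by coefficient, everything is a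
    quotient of factorials and the ratio does not depend on j:

      Omega_0(m | a, b | 2m) = (2m-1)! / (m-1)! * Psi(a, b, 2m).

    Hence, wherever Psi does not vanish, the quotient is the integer
    m (m+1) ... (2m-1), the same for all points ([Omega_ratio]).

    A prime p < 2m divides that product: either p <= m, and a product of m
    consecutive integers is a multiple of m!, or p is itself one of the
    factors.  The primes p_2, ..., p_{k+1} are distinct, so it remains to see
    that p_{k+1} < 2 p_k, which is Bertrand's postulate.  It is proved here by
    the method of Erdos: if there is no prime in (n, 2n], then no prime above
    2n/3 divides 'C(2n, n), and the bounds on the prime powers dividing
    'C(2n, n) make it smaller than 4^n / (2n) for large n
    ([central_bin_le], [bertrand_large]); a chain of primes deals with small
    n ([bertrand]). *)

Set Implicit Arguments.
Unset Strict Implicit.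
Unset Printing Implicit Defensive.

Import Order.TTheory GRing.Theory Num.Theory.
Local Open Scope nat_scope.

(** * Products of primes *)

Lemma dvdn_prod_primes (r : seq nat) (N : nat) :
  uniq r -> all prime r -> all (dvdn^~ N) r -> \prod_(p <- r) p %| N.
Proof.
elim: r => [|p r IHr] /=; first by rewrite big_nil dvd1n.
case/andP=> pNr ur /andP[pp pr] /andP[pN rN]; rewrite big_cons.
rewrite Gauss_dvd ?pN ?IHr //.
rewrite prime_coprime // Euclid_dvd_prod //.
apply/negP; rewrite big_has => /hasP[q qr]; have qp := allP pr _ qr.
by rewrite dvdn_prime2 // => /eqP pq; rewrite pq qr in pNr.
Qed.

Lemma prime_dvd_fact (p n : nat) : prime p -> (p %| n`!) = (p <= n).
Proof.
move=> pp; apply/idP/idP => [|pn]; last by rewrite dvdn_fact // prime_gt0.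
elim: n => [|n IHn]; first by rewrite dvdn1 => /eqP p1; rewrite p1 in pp.
rewrite factS Euclid_dvdM // => /orP[/dvdn_leq->//|/IHn]; exact: leqW.
Qed.

Lemma bin_odd_middle_le (m : nat) : 'C(2 * m + 1, m) <= 4 ^ m.
Proof.
elim: m => [|m IHm]; first by rewrite bin0.
have e1 := mul_bin_diag (2 * m + 3) m.
have e2 := mul_bin_down (2 * m + 2) m.
rewrite (_ : (2 * m + 3).-1 = 2 * m + 2) in e1; last by lia.
rewrite (_ : (2 * m + 2).-1 = 2 * m + 1) in e2; last by lia.
rewrite (_ : 2 * m.+1 + 1 = 2 * m + 3); last by lia.
rewrite (_ : 2 * m + 2 - m = m + 2) in e2; last by lia.
rewrite expnS; move: e1 e2 IHm.
move: ('C(2 * m + 3, m.+1)) ('C(2 * m + 2, m)) ('C(2 * m + 1, m)) (4 ^ m).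
by move=> x y z w e1 e2 zw; nia.
Qed.

(** For n = 2m + 1, the primes in (m + 1, n] all divide 'C(2m + 1, m), which
    is at most 4 ^ m; those up to m + 1 are bounded by induction. *)
Lemma primorial_le (n : nat) : \prod_(0 <= p < n.+1 | prime p) p <= 4 ^ n.
Proof.
elim/ltn_ind: n => n IHn.
have [n2|n3] := leqP n 2.
  by case: n n2 {IHn} => [|[|[|]]] //= _; rewrite unlock.
have [on|en] := boolP (odd n); last first.
  rewrite big_mkcond big_nat_recr //= -big_mkcond /= ifN ?muln1; last first.
    by apply: contra en => pn; case: (even_prime pn) => // n2; lia.
  case: n n3 IHn {en} => // n _ IHn.
  by apply: leq_trans (IHn n _) _ => //; rewrite leq_exp2l.
have nE : n = 2 * n./2 + 1 by rewrite mul2n addn1 -{1}(odd_double_half n) on.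
move: (n./2) nE => m nE; rewrite (big_cat_nat _ (n := m.+2)) //=; last by lia.
apply: (@leq_trans (4 ^ m.+1 * 4 ^ m)); last by rewrite -expnD leq_exp2l //; lia.
apply: leq_mul; first by apply: IHn; lia.
apply: leq_trans (bin_odd_middle_le m); rewrite -big_filter.
apply: dvdn_leq; first by rewrite bin_gt0; lia.
apply: dvdn_prod_primes; first by rewrite filter_uniq ?iota_uniq.
  exact: filter_all.
apply/allP => p; rewrite mem_filter mem_index_iota => /and3P[pp mp pn].
have : p %| (2 * m + 1)`! by rewrite prime_dvd_fact //; lia.
rewrite -(@bin_fact _ m); last by lia.
rewrite !Euclid_dvdM // !prime_dvd_fact // => /or3P[//||]; lia.
Qed.

(** * Bertrand's postulate *)

Lemma central_bin_ge (n : nat) : 0 < n -> 4 ^ n <= 2 * n * 'C(2 * n, n).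
Proof.
elim: n => // -[|n] IHn _; first by [].
have e1 := mul_bin_diag (2 * n.+2) n.+1.
have e2 := mul_bin_down (2 * n + 3) n.+1.
rewrite (_ : (2 * n.+2).-1 = 2 * n + 3) in e1; last by lia.
rewrite (_ : (2 * n + 3).-1 = 2 * n.+1) in e2; last by lia.
rewrite (_ : 2 * n + 3 - n.+1 = n + 2) in e2; last by lia.
have h := IHn isT; rewrite expnS; clear IHn; move: h e1 e2.
move: ('C(2 * n.+2, n.+2)) ('C(2 * n + 3, n.+1)) ('C(2 * n.+1, n.+1)) (4 ^ n.+1).
move=> x y z w h e1 e2; nia.
Qed.

(** Legendre's formula for (2n)! = 'C(2n, n) * n! * n!.  The sums are added
    rather than subtracted to avoid truncation, and run to the same bound 2n
    to be compared term by term. *)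
Lemma logn_central_bin (p n : nat) : prime p ->
  logn p 'C(2 * n, n) + \sum_(1 <= k < (2 * n).+1) 2 * (n %/ p ^ k)
    = \sum_(1 <= k < (2 * n).+1) 2 * n %/ p ^ k.
Proof.
move=> pp; rewrite -(logn_fact _ pp) -(@bin_fact _ n); last by lia.
rewrite (_ : 2 * n - n = n); last by lia.
rewrite !lognM ?muln_gt0 ?fact_gt0 ?bin_gt0 //; last by lia.
rewrite addnn -mul2n logn_fact // -big_distrr /=; congr (_ + 2 * _).
rewrite (big_cat_nat _ (n := n.+1)) //=; last by lia.
rewrite [X in _ + X]big_nat_cond [X in _ + X]big1 ?addn0 // => k.
rewrite andbT => /andP[nk _].
by rewrite divn_small // (leq_trans nk) // ltnW // ltn_expl // prime_gt1.
Qed.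

(** In Legendre's formula each power p ^ k <= 2n contributes at most 1, since
    floor(2x) <= 2 floor(x) + 1, and larger powers contribute nothing. *)
Lemma logn_central_bin_le (p n : nat) : prime p -> 0 < n ->
  p ^ logn p 'C(2 * n, n) <= 2 * n.
Proof.
move=> pp n0; have p1 := prime_gt1 pp.
apply: (@leq_trans (p ^ trunc_log p (2 * n))); last by rewrite trunc_logP //; lia.
rewrite leq_exp2l //; set t := trunc_log _ _.
rewrite -(leq_add2r (\sum_(1 <= k < (2 * n).+1) 2 * (n %/ p ^ k))).
rewrite logn_central_bin // addnC.
apply: (@leq_trans (\sum_(1 <= k < (2 * n).+1) (2 * (n %/ p ^ k) + (k <= t)))).
  apply: leq_sum => k _; have [kt|tk] := leqP k t.
    have q0 : 0 < p ^ k by rewrite expn_gt0 ltnW.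
    have : 2 * n %/ p ^ k < 2 * (n %/ p ^ k) + 2.
      rewrite ltn_divLR //; have := divn_eq n (p ^ k); have := ltn_pmod n q0.
      by move: (n %/ _) (n %% _) => a b; nia.
    by lia.
  rewrite divn_small // ltnNge; apply: contraL tk => /(trunc_log_max p1).
  by rewrite -leqNgt.
rewrite big_split /= leq_add2l.
elim: (2 * n) => [|m IHm]; first by rewrite big_nil.
rewrite big_nat_recr //=; have [mt|tm] := leqP m.+1 t; last by rewrite addn0.
have : \sum_(1 <= k < m.+1) (k <= t) <= \sum_(1 <= k < m.+1) 1.
  by apply: leq_sum => k _; rewrite leq_b1.
by rewrite sum_nat_const_nat; lia.
Qed.

(** Here p and 2p are the only multiples of p up to 2n, and p ^ 2 >= 3p is
    beyond 2n: the exponent 2 of p in (2n)! is cancelled by the two factors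
    n!. *)
Lemma logn_central_bin_eq0 (p n : nat) : prime p -> 2 < p ->
  p <= n -> 2 * n < 3 * p -> logn p 'C(2 * n, n) = 0.
Proof.
move=> pp p2 pn np; have := logn_central_bin n pp.
suff: \sum_(1 <= k < (2 * n).+1) 2 * n %/ p ^ k
        <= \sum_(1 <= k < (2 * n).+1) 2 * (n %/ p ^ k) by lia.
rewrite [leqLHS]big_nat_cond [leqRHS]big_nat_cond.
apply: leq_sum => -[|[|k]] // _.
  rewrite expn1; have n1 : 0 < n %/ p by rewrite divn_gt0 // ltnW // ltnW.
  by apply: (@leq_trans 2); rewrite ?leq_pmulr // -ltnS ltn_divLR // ltnW // ltnW.
rewrite divn_small //; apply: (leq_trans np).
have : 0 < p ^ k by rewrite expn_gt0; lia.
rewrite !expnS; nia.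
Qed.

(** The prime powers in 'C(2n, n) are bounded in three ranges: each of those
    of primes up to s is at most 2n; a prime p > s has p ^ 2 > 2n and so
    exponent at most 1; primes beyond 2n/3 do not occur.  Thus the second
    range contributes at most the product of all primes up to 2n/3. *)
Lemma central_bin_le (n s : nat) : 2 < n -> 2 * n < s.+1 ^ 2 ->
  (forall p, prime p -> n < p -> 2 * n < p) ->
  'C(2 * n, n) <= (2 * n) ^ s * 4 ^ (2 * n %/ 3).
Proof.
move=> n3 ns noprime; set b := 'C(2 * n, n).
have b0 : 0 < b by rewrite bin_gt0; lia.
have logb0 p : 2 * n < p -> logn p b = 0.
  move=> np; apply/eqP; rewrite -leqn0 leqNgt logn_gt0 mem_primes b0 /=.
  apply/negP=> /andP[pp pb]; have : p %| (2 * n)`!.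
    by rewrite -(@bin_fact _ n) ?dvdn_mulr //; lia.
  by rewrite prime_dvd_fact //; lia.
(* The factorization of b, as a product over all p <= 2n; terms at non-primes
   are 1. *)
have -> : b = \prod_(0 <= p < (2 * n).+1) p ^ logn p b.
  rewrite -{1}[b]partnT //.
  rewrite (widen_partn (m := b + 2 * n)) ?leq_addr //.
  rewrite (big_cat_nat _ (n := (2 * n).+1)) //=; last by lia.
  rewrite [X in _ * X]big_nat_cond [X in _ * X]big1 ?muln1 // => p.
  by rewrite andbT => /andP[/logb0-> _].
pose f p := if 0 < p <= s then 2 * n else 1.
pose g p := if (p < (2 * n %/ 3).+1) && prime p then p else 1.
apply: (@leq_trans (\prod_(0 <= p < (2 * n).+1) (f p * g p))).
  apply: leq_prod => p _; rewrite /f /g.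
  have f1 : 0 < (if 0 < p <= s then 2 * n else 1) by case: ifP; lia.
  have [pp|npp] := boolP (prime p); last first.
    by rewrite andbF muln1 lognE (negbTE npp).
  have p0 := prime_gt0 pp; rewrite p0 andbT /=.
  have [ps|sp] := leqP p s.
    apply: leq_trans (logn_central_bin_le pp _) _; first by lia.
    by rewrite leq_pmulr //; case: ifP.
  have logp1 : logn p b <= 1.
    rewrite -ltnS -(ltn_exp2l _ _ (prime_gt1 pp)).
    apply: leq_ltn_trans (logn_central_bin_le pp _) _; first by lia.
    by apply: leq_trans ns _; rewrite leq_exp2r.
  rewrite mul1n; case: ifP => [_|/negbT]; first exact: (leq_pexp2l p0 logp1).
  rewrite -leqNgt ltn_divLR // => p3.
  have [pn|np] := leqP p n; first by rewrite logn_central_bin_eq0 //; lia.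
  by rewrite logb0 // noprime.
rewrite big_split /=; apply: leq_mul.
  apply: (@leq_trans ((2 * n) ^ minn (2 * n) s)); last first.
    by rewrite leq_pexp2l ?geq_minr //; lia.
  elim: {1 3}(2 * n) => [|m IHm]; first by rewrite big_nat1 min0n.
  rewrite big_nat_recr //= {2}/f /=; have [ms|sm] := leqP m.+1 s.
    by move: IHm; rewrite (minn_idPl (ltnW ms)) expnSr => IHm; rewrite leq_mul.
  by move: IHm; rewrite muln1 (minn_idPr (sm : s <= m)).
rewrite -big_mkcond (big_cat_nat _ (n := (2 * n %/ 3).+1)) //=; last first.
  by rewrite ltnS leq_div.
rewrite [X in _ * X]big_nat_cond [X in _ * X]big_pred0 ?muln1; last first.
  by move=> p; rewrite [p < (_ %/ _).+1]ltnS; case: leqP; rewrite /= ?andbF.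
apply: leq_trans (primorial_le _); rewrite big_nat_cond [leqRHS]big_nat_cond.
by rewrite (eq_bigl (fun p => (p < (2 * n %/ 3).+1) && prime p)) // => p; case: ltnP.
Qed.

(** Induction on t: the left side at most doubles from t to t + 1, because
    (t + 1) ^ 6 <= 2 t ^ 6. *)
Lemma exp6_le_exp2 (t : nat) : 51 <= t -> 4 * t ^ 6 <= 2 ^ t.
Proof.
(* For 51 ^ 6 it suffices to bound 51 by 2 ^ 6; stated with variables so that
   no large unary numeral is computed. *)
have base a b : a <= 2 ^ 6 -> 38 <= b -> 4 * a ^ 6 <= 2 ^ b.
  move=> a6 b38; apply: (@leq_trans (2 ^ (2 + 36))); last by rewrite leq_exp2l.
  by rewrite expnD leq_mul2l (expnM 2 6 6) leq_exp2r.
elim: t => [|t IHt] //; rewrite leq_eqVlt => /predU1P[<-|]; first exact: base.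
rewrite ltnS => t51; have := IHt t51; rewrite [2 ^ t.+1]expnS.
(* Cubed, this gives (t + 1) ^ 6 <= 2 t ^ 6, because (5/4) ^ 3 < 2. *)
have h : 4 * t.+1 ^ 2 <= 5 * t ^ 2 by rewrite !expnS !expn0; nia.
have : (4 * t.+1 ^ 2) ^ 3 <= (5 * t ^ 2) ^ 3 by rewrite leq_exp2r.
rewrite (expnMn 4) (expnMn 5) -!expnM; move: (t.+1 ^ _) (t ^ _) (2 ^ t) => x y z.
by have [-> ->] : 4 ^ 3 = 64 /\ 5 ^ 3 = 125 by []; lia.
Qed.

(** With s the integer square root of 2n and t = s + 1, the absence of primes
    gives 4 ^ n <= (2n) ^ t * 4 ^ (2n/3), hence 4 ^ n <= (2n) ^ (3t) <= t ^ (6t).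
    As 2n >= (t - 1) ^ 2, multiplying by 4 ^ t contradicts
    4 * t ^ 6 <= 2 ^ t. *)
Lemma bertrand_large (n : nat) : 1259 <= n -> exists2 p, prime p & n < p <= 2 * n.
Proof.
move=> nL; have [/hasP[p]|/hasPn noprime] :=
  boolP (has prime (index_iota n.+1 (2 * n).+1)).
  by rewrite mem_index_iota ltnS => np pp; exists p.
have ex_s : exists s, s ^ 2 <= 2 * n by exists 0.
have bd s : s ^ 2 <= 2 * n -> s <= 2 * n by rewrite expnS expn1; nia.
case: (ex_maxnP ex_s bd) => s sn smax.
have ns : 2 * n < s.+1 ^ 2.
  by rewrite ltnNge; apply/negP => /smax; rewrite ltnn.
have t51 : 51 <= s.+1.
  rewrite leqNgt; apply/negP => st; move: ns; rewrite expnS expn1.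
  have : s.+1 * s.+1 <= 50 * 50 by apply: leq_mul.
  lia.
have Cle : 'C(2 * n, n) <= (2 * n) ^ s * 4 ^ (2 * n %/ 3).
  apply: central_bin_le => // [|p pp np]; first by lia.
  rewrite ltnNge; apply/negP => pn; have := noprime p; rewrite pp mem_index_iota.
  by rewrite np ltnS pn => /(_ isT).
have le1 : 4 ^ n <= (2 * n) ^ s.+1 * 4 ^ (2 * n %/ 3).
  apply: leq_trans (central_bin_ge _) _; first by lia.
  by rewrite expnS -[leqRHS]mulnA leq_mul2l Cle orbT.
have le2 : 4 ^ n <= s.+1 ^ (6 * s.+1).
  have : (4 ^ n) ^ 3 <= ((2 * n) ^ s.+1 * 4 ^ (2 * n %/ 3)) ^ 3 by rewrite leq_exp2r.
  rewrite expnMn -!expnM (_ : n * 3 = n + 2 * n); last by lia.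
  rewrite expnD => h.
  rewrite -(leq_pmul2r (_ : 0 < 4 ^ (2 * n))) ?expn_gt0 //.
  apply: (leq_trans h); apply: leq_mul; last by rewrite leq_exp2l // leq_divM.
  rewrite (_ : 6 * s.+1 = 2 * (s.+1 * 3)); last by lia.
  by rewrite (expnM _ 2) leq_exp2r ?muln_gt0 // ltnW.
(* The left side is 2 ^ (s ^ 2) * 4 ^ (s + 1), because
   (s + 1) ^ 2 + 1 = s ^ 2 + 2 (s + 1), and s ^ 2 <= 2n. *)
have : 2 ^ (s.+1 ^ 2).+1 <= 2 ^ (s.+1 ^ 2).
  have le3 : (4 * s.+1 ^ 6) ^ s.+1 <= (2 ^ s.+1) ^ s.+1.
    by rewrite leq_exp2r // exp6_le_exp2.
  rewrite -[in leqRHS]mulnn expnM; apply: leq_trans le3.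
  rewrite expnMn -expnM; apply: (@leq_trans (4 ^ s.+1 * 4 ^ n)).
    rewrite -expnD (_ : 4 = 2 ^ 2) // -expnM leq_exp2l //; move: sn.
    by rewrite -!mulnn; lia.
  by rewrite leq_mul2l le2 orbT.
by rewrite leq_exp2l // ltnn.
Qed.

Lemma bertrand (n : nat) : 0 < n -> exists2 p, prime p & n < p <= 2 * n.
Proof.
move=> n0; have [|nS] := leqP 1259 n; first exact: bertrand_large.
(* If the prime q is at most 2p, it serves every n with p <= n < q. *)
have chain p q : prime q -> q <= 2 * p ->
    (n < p -> exists2 p, prime p & n < p <= 2 * n) ->
    n < q -> exists2 p, prime p & n < p <= 2 * n.
  by move=> pq qp IH nq; have [/IH//|pn] := ltnP n p; exists q => //; lia.
move: nS; apply: (@chain 631) => //; apply: (@chain 317) => //.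
apply: (@chain 163) => //; apply: (@chain 83) => //; apply: (@chain 43) => //.
apply: (@chain 23) => //; apply: (@chain 13) => //; apply: (@chain 7) => //.
apply: (@chain 5) => //; apply: (@chain 3) => //; apply: (@chain 2) => //.
by apply: (@chain 1) => //; lia.
Qed.

(** * Prime factors of (2m-1)!/(m-1)! *)

Lemma nth_prime_mono (i j : nat) : (i <= j)%N -> (nth_prime i <= nth_prime j)%N.
Proof.
move/subnKC <-; elim: (j - i)%N => [|l IHl]; first by rewrite addn0.
have [_ lt_l _] := nth_primeS (i + l); rewrite addnS.
exact: leq_trans IHl (ltnW lt_l).
Qed.

Lemma nth_prime_inj : injective nth_prime.
Proof.
have lt_mono i j : (i < j)%N -> (nth_prime i < nth_prime j)%N.
  by move/nth_prime_mono; apply: leq_trans; have [] := nth_primeS i.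
move=> i j eq_ij; have [/lt_mono|/lt_mono|//] := ltngtP i j;
  by rewrite eq_ij ltnn.
Qed.

(** Bertrand's postulate allows the value 2 * nth_prime k itself, which is not
    prime. *)
Lemma nth_prime_bertrand (k : nat) : (0 < k)%N ->
  (nth_prime k.+1 < 2 * nth_prime k)%N.
Proof.
case: k => // k _; have [pk lt_k _] := nth_primeS k.
have [q pq /andP[kq qk]] := bertrand (prime_gt0 pk).
have [_ _ min_k] := nth_primeS k.+1; apply: leq_ltn_trans (min_k q pq kq) _.
rewrite ltn_neqAle qk andbT; apply: contraL pq => /eqP->.
apply/negP => p2; have := @dvdn_prime2 2 _ isT p2; rewrite dvdn_mulr // => /esym/eqP.
by have := prime_gt1 pk; lia.
Qed.

(** The falling factorial is m (m+1) ... (2m-1): it is a multiple of m!, and a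
    prime strictly between m and 2m is one of its factors. *)
Lemma prime_dvd_ffact (p m : nat) :
  prime p -> (0 < m)%N -> (p < 2 * m)%N -> (p %| (2 * m).-1 ^_ m)%N.
Proof.
move=> pp m0 pm; have [p_le|p_gt] := leqP p m.
  by rewrite -bin_ffact dvdn_mull // prime_dvd_fact.
have : (p %| (2 * m).-1`!)%N by rewrite prime_dvd_fact //; lia.
rewrite -(@ffact_fact _ m) ?Euclid_dvdM //; last by lia.
by case/orP => //; rewrite prime_dvd_fact //; lia.
Qed.

Lemma primes_dvd_ffact (k : nat) : (0 < k)%N ->
  (\prod_(2 <= i < k.+2) nth_prime i
     %| (2 * nth_prime k).-1 ^_ (nth_prime k))%N.
Proof.
move=> k0; rewrite -(big_map nth_prime xpredT id) /=.
apply: dvdn_prod_primes.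
- by rewrite map_inj_uniq ?iota_uniq //; exact: nth_prime_inj.
- apply/allP => _ /mapP[i + ->]; rewrite mem_index_iota => /andP[i2 _].
  by case: i i2 => // i _; have [] := nth_primeS i.
apply/allP => _ /mapP[i + ->]; rewrite mem_index_iota => /andP[i2 ik].
have pk : prime (nth_prime k) by case: k k0 {ik} => // k _; have [] := nth_primeS k.
apply: prime_dvd_ffact; last 1 first.
- exact: leq_ltn_trans (nth_prime_mono (ik : (i <= k.+1)%N)) (nth_prime_bertrand k0).
- by case: i i2 {ik} => // i _; have [] := nth_primeS i.
- exact: prime_gt0.
Qed.

(** * Lucas coefficients *)

(** The coefficient of (-a) ^ j * c ^ (n./2 - j) in Psi, with c = 2a - b; the
    recursion in n is that of Psi. *)
Fixpoint lucas_coef (n j : nat) : nat :=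
  match n with
  | 0 => if j is 0 then 2 else 0
  | m.+1 =>
      match m with
      | 0 => if j is 0 then 1 else 0
      | l.+1 => lucas_coef m j + (if j is i.+1 then lucas_coef l i else 0)
      end
  end%N.

Arguments lucas_coef : simpl never.

Lemma lucas_coefSS (n j : nat) :
  lucas_coef n.+2 j =
    (lucas_coef n.+1 j + (if j is i.+1 then lucas_coef n i else 0))%N.
Proof. by []. Qed.

Lemma lucas_coef_small (n j : nat) : (n < 2 * j)%N -> lucas_coef n j = 0%N.
Proof.
elim/ltn_ind: n j => -[|[|n]] IHn [|j] // nj.
by rewrite lucas_coefSS !IHn //; lia.
Qed.

(** The formula n / (n - j) * 'C(n - j, j) for [lucas_coef n j], with
    n = 2j + d and the denominators cleared. *)
Lemma lucas_coef_fact (j d : nat) : (0 < j + d)%N ->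
  (lucas_coef (2 * j + d) j * (j`! * d`!) = (2 * j + d) * (j + d).-1`!)%N.
Proof.
elim: j d => [|j IHj] d; first case: d => [|d] // _.
  rewrite muln0 add0n fact0 mul1n factS mulnA; congr (_ * _)%N.
  rewrite -[RHS]mul1n; congr muln.
  by elim: d => // d IHd; rewrite lucas_coefSS IHd.
move=> _; elim: d => [|d IHd].
  rewrite addn0 (_ : (2 * j.+1)%N = (2 * j).+2)%N; last by lia.
  rewrite lucas_coefSS lucas_coef_small ?add0n; last by lia.
  case: j IHj => [|j] IHj; first by [].
  have := IHj 0%N isT; rewrite !addn0 /= fact0 !muln1 [(j.+2)`!]factS => e.
  by rewrite mulnCA e factS; lia.
rewrite (_ : (2 * j.+1 + d.+1)%N = (2 * j + d.+1).+2)%N; last by lia.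
rewrite lucas_coefSS.
have := IHj d.+1; rewrite addnS => /(_ isT) /=.
move: IHd; rewrite (_ : (2 * j.+1 + d)%N = (2 * j + d.+1).+1)%N; last by lia.
rewrite (_ : (j.+1 + d).-1 = j + d)%N // ?addnS.
rewrite !factS; move: (lucas_coef _ _) (lucas_coef _ _) (j`!) (d`!) ((j + d)`!).
move=> x y u v w e1 e2; nia.
Qed.

(** (2m - 1)(2m - 3) ... (2m - 2j + 1) as a quotient of factorials, for
    m = e + j and cleared of denominators. *)
Lemma odd_prod_fact (e j : nat) :
  (2 ^ j * (\prod_(i < j) (2 * (e + j) - 2 * i - 1)) * ((e + j)`! * (2 * e)`!)
     = (2 * (e + j))`! * e`!)%N.
Proof.
elim: j => [|j IHj]; first by rewrite big_ord0 addn0; lia.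
rewrite big_ord_recl /=.
rewrite (eq_bigr (fun i : 'I_j => 2 * (e + j) - 2 * i - 1)%N); last first.
  by move=> i _; rewrite /bump /=; lia.
rewrite expnS (_ : (2 * (e + j.+1) - 2 * 0 - 1)%N = (2 * (e + j)).+1); last by lia.
rewrite (_ : (2 * (e + j.+1))%N = (2 * (e + j)).+2); last by lia.
rewrite addnS !factS; move: IHj; move: (2 ^ j)%N (\prod_(i < j) _)%N => x y.
move: ((e + j)`!) ((2 * e)`!) ((2 * (e + j))`!) (e`!) => z w u v h.
transitivity ((2 * (e + j).+1 * (2 * (e + j)).+1) * (x * y * (z * w)))%N; first by ring.
by rewrite h; ring.
Qed.

Lemma rising_prod_fact (m l : nat) : (0 < m)%N ->
  ((\prod_(i < l) (m + i)) * m.-1`! = (m + l).-1`!)%N.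
Proof.
case: m => // m _; elim: l => [|l IHl]; first by rewrite big_ord0 mul1n addn0.
by rewrite big_ord_recr /= mulnAC IHl addnS !addSn /= factS mulnC.
Qed.

(** Equality of the coefficients of (-a) ^ j * c ^ e in the expansions of
    Omega_0(m | 2m) and of (2m-1)!/(m-1)! times Psi(2m), where m = e + j.
    After multiplication by factorials both sides become
    m! e! (2m)! (m + e - 1)!. *)
Lemma Omega_coef_eq (e j : nat) : (0 < e + j)%N ->
  ('C(e + j, j) * (2 ^ j * \prod_(i < j) (2 * (e + j) - 2 * i - 1))
     * \prod_(i < e) (e + j + i)
   = (2 * (e + j)).-1 ^_ (e + j) * lucas_coef (2 * (e + j)) j)%N.
Proof.
move=> m0; have binE := @bin_fact (e + j) j (leq_addl _ _).
have dblE := odd_prod_fact e j.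
have risE := rising_prod_fact e m0.
have lucE : (lucas_coef (2 * (e + j)) j * (j`! * (2 * e)`!)
    = (2 * (e + j)) * (e + j + e).-1`!)%N.
  have := @lucas_coef_fact j (2 * e)%N.
  rewrite (_ : (2 * j + 2 * e)%N = (2 * (e + j))%N); last by lia.
  by rewrite (_ : (j + 2 * e)%N = (e + j + e)%N); [apply; lia | lia].
have ffE : ((2 * (e + j)).-1 ^_ (e + j) * (e + j).-1`! = (2 * (e + j)).-1`!)%N.
  rewrite -(@ffact_fact (2 * (e + j)).-1 (e + j)); last by lia.
  by congr (_ * _`!)%N; lia.
have factE : ((2 * (e + j))`! = 2 * (e + j) * (2 * (e + j)).-1`!)%N.
  by rewrite -[in LHS](@prednK (2 * (e + j))) ?factS ?prednK //; lia.
rewrite addnK in binE; rewrite factE in dblE.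
have K0 : (0 < j`! * e`! * (e + j)`! * (2 * e)`! * (e + j).-1`!)%N.
  by rewrite !muln_gt0 !fact_gt0.
apply/eqP; rewrite -(eqn_pmul2r K0); apply/eqP.
move: (2 ^ j * _)%N (\prod_(i < e) _)%N (_ ^_ _)%N (lucas_coef _ _) ('C(_, _))
  binE dblE risE lucE ffE => x y z l c binE dblE risE lucE ffE.
move: binE dblE risE lucE ffE {K0 factE}.
move: ((e + j + e).-1`!) ((2 * (e + j)).-1`!) ((e + j).-1`!) (j`!) (e`!) ((2 * e)`!)
  ((e + j)`!) => f1 f2 f3 f4 f5 f6 f7 binE dblE risE lucE ffE.
transitivity ((c * (f4 * f5)) * (x * (f7 * f6)) * (y * f3))%N; first by ring.
transitivity ((z * f3) * (l * (f4 * f6)) * (f5 * f7))%N; last by ring.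
by rewrite binE dblE risE lucE ffE; ring.
Qed.

Local Open Scope ring_scope.

(** * Closed forms of Psi and Omega *)

(** The sum runs past n./2, where the coefficients vanish, so that no case
    distinction on the parity of n enters the bounds. *)
Lemma Psi_closed (R : realType) (a b : R) (n : nat) :
  Psi a b n = \sum_(j < n.+1)
    (lucas_coef n j)%:R * (- a) ^+ j * (2 * a - b) ^+ (n./2 - j).
Proof.
elim/ltn_ind: n => -[|[|n]] IHn.
- by rewrite big_ord1 /= !mulr1.
- by rewrite !big_ord_recl big_ord0 /= !mulr1 !mul0r !addr0.
have -> : Psi a b n.+2 = (2 * a - b) ^+ delta n.+1 * Psi a b n.+1 - a * Psi a b n by [].
rewrite !IHn //; set c := 2 * a - b.
under [RHS]eq_bigr do rewrite lucas_coefSS natrD !mulrDl.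
rewrite big_split /=; congr (_ + _).
  rewrite [RHS]big_ord_recr /= lucas_coef_small ?mul0r ?addr0; last by lia.
  rewrite mulr_sumr; apply: eq_bigr => j _.
  have [jn|nj] := leqP (2 * j) n.+1; last by rewrite lucas_coef_small // !mul0r mulr0.
  rewrite mulrCA -exprD; congr (_ * c ^+ _).
  rewrite /delta modn2 /= uphalf_half; move: jn.
  rewrite -[n in (_ <= n.+1)%N -> _]odd_double_half.
  by case: (odd n) => /=; lia.
rewrite [RHS]big_ord_recl !mul0r add0r [RHS]big_ord_recr /=.
rewrite [X in _ = _ + X](_ : _ = 0) ?addr0; last by rewrite lucas_coef_small ?mul0r //; lia.
rewrite mulr_sumr -sumrN; apply: eq_bigr => j _.
rewrite /bump /= add1n exprS subSS; ring.
Qed.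

(** The index j counts the steps of the recursion that raise r.  The factors
    n - 2r - delta collected by such steps, and the factors n - (r + k)
    collected by the others, do not depend on the order of the steps. *)
Lemma Omega_closed (R : realType) (a b : R) (n r k : nat) :
  Omega a b n r k = \sum_(j < k.+1)
    ('C(k, j))%:R * (2 * a - b) ^+ (k - j) * (- (2 * a)) ^+ j
    * (\prod_(i < j) (n%:R - 2 * (r + i)%:R - (delta n.-1)%:R))
    * (\prod_(i < k - j) (n%:R - (r + k)%:R + i%:R)).
Proof.
elim: k r => [|k IHk] r.
  by rewrite big_ord1 /= !big_ord0 bin0 !mulr1.
rewrite /= !IHk; set c := 2 * a - b; set d : R := (delta n.-1)%:R.
(* Pascal's rule separates the paths according to their first step. *)
under [RHS]eq_bigr => j _.
  rewrite (_ : ('C(k.+1, j))%:R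
    = ('C(k, j))%:R + (if (j : nat) is i.+1 then 'C(k, i) else 0)%:R :> R).
    rewrite 4!mulrDl. over.
  by case: (j : nat) => [|i]; rewrite ?bin0 ?addr0 // binS natrD.
rewrite big_split /=; congr (_ + _).
  rewrite [RHS]big_ord_recr /= bin_small // !mul0r addr0 mulr_sumr.
  apply: eq_bigr => j _; have jk : (j <= k)%N by rewrite -ltnS.
  rewrite subSn // exprS big_ord_recl /=.
  rewrite (_ : \prod_(i < k - j) (n%:R - (r + k.+1)%:R + (bump 0 i)%:R)
      = \prod_(i < k - j) (n%:R - (r + k)%:R + i%:R) :> R); last first.
    apply: eq_bigr => i _; rewrite /bump /= add1n addnS -!natr1. ring.
  rewrite addr0 (natrD _ r k.+1) (natrD _ r k) -(natr1 k); ring.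
rewrite [RHS]big_ord_recl !mul0r add0r mulr_sumr -sumrN.
apply: eq_bigr => j _.
rewrite (_ : lift ord0 j = j.+1 :> nat) // subSS exprS [in RHS]big_ord_recl /= addn0.
rewrite addSnnS (_ : \prod_(i < j) (n%:R - 2 * (r + bump 0 i)%:R - d)
    = \prod_(i < j) (n%:R - 2 * (r.+1 + i)%:R - d)); last first.
  by apply: eq_bigr => i _; rewrite /bump /= add1n addSnnS.
ring.
Qed.

(** Both closed forms become sums over j <= m, the terms of Psi with j > m
    being zero, and their terms are proportional with the same factor. *)
Lemma Omega_eq_Psi (R : realType) (a b : R) (m : nat) : (0 < m)%N ->
  Omega a b (2 * m) 0 m = ((2 * m).-1 ^_ m)%:R * Psi a b (2 * m).
Proof.
move=> m0; rewrite Omega_closed Psi_closed.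
rewrite -!(big_mkord xpredT (fun j => (lucas_coef _ j)%:R * _ ^+ j * _ ^+ (_ - j))).
rewrite [in RHS](big_cat_nat _ (n := m.+1)) //=; last by lia.
rewrite [X in _ = _ * (_ + X)]big_nat_cond [X in _ = _ * (_ + X)]big1 ?addr0; last first.
  move=> j; rewrite andbT => /andP[mj _].
  by rewrite lucas_coef_small ?mul0r //; lia.
rewrite big_mkord mulr_sumr; apply: eq_bigr => -[j /=]; rewrite ltnS => jm _.
have -> : ((2 * m)./2 = m)%N by rewrite mul2n doubleK.
have -> : delta (2 * m).-1 = 1%N by rewrite /delta; lia.
have [e em] : exists e, m = (e + j)%N by exists (m - j)%N; rewrite subnK.
rewrite em addnK; rewrite em in m0.
have -> : \prod_(i < j) ((2 * (e + j))%:R - 2 * (0 + i)%:R - 1%:R)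
    = (\prod_(i < j) (2 * (e + j) - 2 * i - 1))%N%:R :> R.
  rewrite natr_prod; apply: eq_bigr => i _; have ij := ltn_ord i.
  have [i1 i2] : (1 <= 2 * (e + j) - 2 * i)%N /\ (2 * i <= 2 * (e + j))%N by lia.
  by rewrite add0n (natrB _ i1) (natrB _ i2) (natrM _ 2 i).
have -> : \prod_(i < e) ((2 * (e + j))%:R - (0 + (e + j))%:R + i%:R)
    = (\prod_(i < e) (e + j + i))%N%:R :> R.
  rewrite natr_prod; apply: eq_bigr => i _; rewrite add0n (natrM _ 2) (natrD _ (e + j)).
  ring.
rewrite -mulrN exprMn.
have := congr1 (fun k => k%:R : R) (Omega_coef_eq m0).
rewrite !natrM natrX => coefE.
rewrite !mulrA -coefE; ring.
Qed.

Lemma Omega_ratio (R : realType) (a b : R) (k : nat) : (0 < k)%N ->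
  (a, b) \in Omega_space R (2 * nth_prime k)%N ->
  Omega a b (2 * nth_prime k)%N 0 (nth_prime k) / Psi a b (2 * nth_prime k)%N
    = ((2 * nth_prime k).-1 ^_ (nth_prime k))%:R.
Proof.
move=> k0; rewrite inE /= => /andP[_ Psi_neq0].
rewrite Omega_eq_Psi ?mulfK //; case: k k0 {Psi_neq0} => // k _.
by have [/prime_gt0] := nth_primeS k.
Qed.

Theorem theorem49 (R : realType) (k : nat) (hk : (1 < k)%N) :
  (forall alpha beta : R,
     (alpha, beta) \in Omega_space R (2 * nth_prime k)%N ->
     int_multiple (\prod_(2 <= i < k.+2) nth_prime i)%N
       (Omega alpha beta (2 * nth_prime k)%N 0 (nth_prime k)
        / Psi alpha beta (2 * nth_prime k)%N))
  /\
  (forall (varpi : {fset R * R}) (I : {fset int}),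
     {subset varpi <= Omega_space R (2 * nth_prime k)%N} ->
     int_multiple (\prod_(2 <= i < k.+2) nth_prime i)%N
       (\sum_(x <- varpi) \sum_(lambda <- I)
          lambda%:~R *
          (Omega x.1 x.2 (2 * nth_prime k)%N 0 (nth_prime k)
           / Psi x.1 x.2 (2 * nth_prime k)%N))).
Proof.
have k0 : (0 < k)%N by exact: ltnW.
set N : int := (2 * nth_prime k).-1 ^_ (nth_prime k).
have dvdN : (((\prod_(2 <= i < k.+2) nth_prime i)%N)%:Z %| N)%Z.
  exact: primes_dvd_ffact.
split=> [a b ab|varpi I sub].
  by exists N => //; rewrite Omega_ratio.
exists (\sum_(x <- varpi) \sum_(lambda <- I) lambda * N); last first.
  by apply: rpred_sum => x _; apply: rpred_sum => l _; rewrite dvdz_mull.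
rewrite rmorph_sum /=; apply: eq_big_seq => x x_in.
rewrite rmorph_sum /=; apply: eq_bigr => l _; rewrite rmorphM /=.
by rewrite Omega_ratio -?surjective_pairing ?sub.
Qed.
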